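(* If $G$ is a strong $\mathfrak{I}$-contractible graph, then $G$ is a collapsible graph, i.e. its clique complex $\Delta(G)$ collapses to a point.
   Context: Graphs are finite, undirected, without loops or multiple edges. For a vertex $v$ of $G$, $N_G(v)$ denotes the subgraph induced on the vertices adjacent to $v$; for vertices $v_1,v_2$, $N_G(v_1,v_2)$ is the subgraph induced on $N_G(v_1)\cap N_G(v_2)$. The family $\mathfrak{I}_S$ of strong $\mathfrak{I}$-contractible graphs is the smallest family of graphs containing the one-vertex graph $K(1)$ and closed under: (I2) gluing a vertex: if $G\in\mathfrak{I}_S$ and $G'$ is an induced subgraph of $G$ with $G'\in\mathfrak{I}_S$, then the graph obtained by adding a new vertex $v$ adjacent exactly to the vertices of $G'$ (so $N(v)=G'$) is in $\mathfrak{I}_S$; (I4) gluing an edge: if $G\in\mathfrak{I}_S$ and $v_1,v_2$ are nonadjacent vertices of $G$ with $N_G(v_1,v_2)\in\mathfrak{I}_S$, then $G$ with the edge $\{v_1,v_2\}$ added is in $\mathfrak{I}_S$. The clique complex $\Delta(G)$ is the abstract simplicial complex whose simplices are the vertex sets of complete subgraphs of $G$. In a simplicial complex $\Delta$, a pair $\sigma\subsetneq\tau$ is free if $\tau$ is a maximal face and no other maximal face contains $\sigma$; a collapse removes all $\gamma$ with $\sigma\subseteq\gamma\subseteq\tau$. $\Delta$ is collapsible if it can be reduced to a single vertex $\Delta^0$ by a finite sequence of collapses. A graph $G$ is collapsible if $\Delta(G)$ is collapsible. *)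

(* Defs.v *)
From mathcomp Require Import all_boot.

Set Implicit Arguments.
Unset Strict Implicit.
Unset Printing Implicit Defensive.

Record sgraph := SGraph {
  vertex :> finType;
  edge : rel vertex;
  edge_sym : symmetric edge;
  edge_irrefl : irreflexive edge
}.

Arguments edge {G} : rename.
Arguments edge_sym {G} : rename.
Arguments edge_irrefl {G} : rename.

Definition graph_iso (G H : sgraph) : Prop :=
  exists f : G -> H, bijective f /\ {mono f : x y / edge x y}.

Section Constructions.

Definition K1_edge : rel unit := fun _ _ => false.

Fact K1_edge_sym : symmetric K1_edge. Proof. by []. Qed.

Fact K1_edge_irrefl : irreflexive K1_edge. Proof. by []. Qed.

Definition K1 : sgraph := SGraph K1_edge_sym K1_edge_irrefl.

Variable G : sgraph.

Definition induced_edge (A : {set G}) : rel {x : G | x \in A} :=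
  fun x y => edge (val x) (val y).

Fact induced_edge_sym A : symmetric (@induced_edge A).
Proof. by move=> x y; apply: edge_sym. Qed.

Fact induced_edge_irrefl A : irreflexive (@induced_edge A).
Proof. by move=> x; apply: edge_irrefl. Qed.

Definition induced (A : {set G}) : sgraph :=
  SGraph (@induced_edge_sym A) (@induced_edge_irrefl A).

Definition common_nbrs (v1 v2 : G) : {set G} :=
  [set x | edge v1 x && edge v2 x].

(* The new vertex is [None]. *)
Definition add_vertex_edge (A : {set G}) : rel (option G) :=
  fun x y => match x, y with
  | Some x', Some y' => edge x' y'
  | Some x', None => x' \in A
  | None, Some y' => y' \in A
  | None, None => false
  end.

Fact add_vertex_edge_sym A : symmetric (add_vertex_edge A).
Proof. by move=> [x|] [y|] //=; apply: edge_sym. Qed.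

Fact add_vertex_edge_irrefl A : irreflexive (add_vertex_edge A).
Proof. by move=> [x|] //=; apply: edge_irrefl. Qed.

Definition add_vertex (A : {set G}) : sgraph :=
  SGraph (@add_vertex_edge_sym A) (@add_vertex_edge_irrefl A).

(* The conjunct [x != y] makes the relation irreflexive for all v1, v2; it is
   redundant when v1 != v2. *)
Definition add_edge_edge (v1 v2 : G) : rel G :=
  fun x y => edge x y || (x != y) && ([set x; y] == [set v1; v2]).

Fact add_edge_edge_sym v1 v2 : symmetric (add_edge_edge v1 v2).
Proof.
by move=> x y; rewrite /add_edge_edge edge_sym eq_sym (setUC [set x]).
Qed.

Fact add_edge_edge_irrefl v1 v2 : irreflexive (add_edge_edge v1 v2).
Proof. by move=> x; rewrite /add_edge_edge edge_irrefl eqxx. Qed.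

Definition add_edge (v1 v2 : G) : sgraph :=
  SGraph (@add_edge_edge_sym v1 v2) (@add_edge_edge_irrefl v1 v2).

End Constructions.

(* Graphs are considered up to isomorphism, hence [SC_iso]: without it no
   neighbourhood, whose vertices form a sigma-type, could be [K1]. *)
Inductive strong_contractible : sgraph -> Prop :=
| SC_K1 : strong_contractible K1
| SC_glue_vertex (G : sgraph) (A : {set G}) :
    strong_contractible G -> strong_contractible (induced A) ->
    strong_contractible (add_vertex A)
| SC_glue_edge (G : sgraph) (v1 v2 : G) :
    strong_contractible G -> v1 != v2 -> ~~ edge v1 v2 ->
    strong_contractible (induced (common_nbrs v1 v2)) ->
    strong_contractible (add_edge v1 v2)
| SC_iso (G H : sgraph) :
    graph_iso G H -> strong_contractible G -> strong_contractible H.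

(* Complexes are given by their set of nonempty faces. *)
Definition simplicial_complex (T : finType) (K : {set {set T}}) : Prop :=
  forall s, s \in K ->
    s != set0 /\ (forall r : {set T}, r != set0 -> r \subset s -> r \in K).

Section Collapse.
Variable T : finType.
Implicit Types (K : {set {set T}}) (s t : {set T}).

Definition maximal_face K t : bool := maxset [in K] t.

Definition free_pair K s t : bool :=
  [&& s \in K, s \proper t, maximal_face K t &
      [forall u, maximal_face K u && (s \subset u) ==> (u == t)]].

Definition collapse K s t : {set {set T}} :=
  K :\: [set g : {set T} | (s \subset g) && (g \subset t)].

Definition collapse_step : rel {set {set T}} :=
  fun K K' => [exists s, exists t, free_pair K s t && (K' == collapse K s t)].

Definition collapsible K : Prop :=
  exists v : T, connect collapse_step K [set [set v]].

Lemma collapse_simplicial K s t :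
  free_pair K s t -> simplicial_complex K ->
  simplicial_complex (collapse K s t).
Proof.
case/and4P=> _ _ tmax /forallP funiq cK g; rewrite !inE => /andP[gN gK].
have [g0 sub] := cK g gK; split=> // r r0 rg; rewrite !inE (sub r) // andbT.
apply: contra gN => /andP[sr rt]; have sg := subset_trans sr rg.
have [u umax gu] := maxset_exists (P := [in K]) gK.
move: (funiq u); rewrite /maximal_face umax (subset_trans sg gu) /= => /eqP <-.
by rewrite sg gu.
Qed.

End Collapse.

Definition is_clique (G : sgraph) (A : {set G}) : bool :=
  [forall x in A, forall y in A, (x != y) ==> edge x y].

Definition clique_complex (G : sgraph) : {set {set G}} :=
  [set A | (A != set0) && is_clique A].

Lemma clique_complex_simplicial (G : sgraph) :
  simplicial_complex (clique_complex G).
Proof.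
move=> s; rewrite inE => /andP[s0 /forall_inP cs]; split=> // r r0 /subsetP rs.
rewrite inE r0; apply/forall_inP => x xr; apply/forall_inP => y yr.
by move/forall_inP: (cs x (rs _ xr)); apply; apply: rs.
Qed.

Definition collapsible_graph (G : sgraph) : Prop :=
  collapsible (clique_complex G).

(* Main.v *)
Require Import Defs.
From mathcomp Require Import all_boot.

Set Implicit Arguments.
Unset Strict Implicit.
Unset Printing Implicit Defensive.

(** Gluing a vertex [v] (resp. an edge [v1 v2]) adds to the clique complex
    exactly the face [a = {v}] (resp. [a = {v1, v2}]) and the faces [a :|: g],
    for [g] a clique of the (common) neighbourhood.  A collapse of a free pair
    [(s, t)] of the neighbourhood complex lifts to a collapse of the free pair
    [(a :|: s, a :|: t)].  Once the neighbourhood has been collapsed to a point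
    [w], the pair [(a, w |: a)] is free, and collapsing it leaves the clique
    complex of the original graph. *)

(** * Free pairs and elementary collapses *)

(** Every face lies in a maximal one, so a unique maximal face above [s] is the same as a greatest
    face above [s]. *)
Lemma free_pairP (T : finType) (K : {set {set T}}) (s t : {set T}) :
  reflect [/\ s \in K, s \proper t, t \in K &
             forall u, u \in K -> s \subset u -> u \subset t]
          (free_pair K s t).
Proof.
apply: (iffP and4P) => [[sK st tmax /forallP funiq]|[sK st tK sub]].
  split=> // [|u uK su]; first by case/maxsetP: tmax.
  have [m mmax um] := maxset_exists (P := [in K]) uK.
  move: (funiq m); rewrite /maximal_face mmax (subset_trans su um) /=.
  by move/eqP=> <-.
split=> //.
  apply/maxsetP; split=> // u uK tu; apply/eqP; rewrite eqEsubset tu andbT.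
  by apply: sub => //; apply: subset_trans (proper_sub st) tu.
apply/forallP=> u; apply/implyP=> /andP[/maxsetP[uK umax] su].
by rewrite (umax t) ?sub.
Qed.

Lemma collapse_stepP (T : finType) (K K' : {set {set T}}) :
  reflect (exists s t, free_pair K s t /\ K' = collapse K s t)
          (collapse_step K K').
Proof.
apply: (iffP existsP) => [[s /existsP[t /andP[fr /eqP ->]]]|[s [t [fr ->]]]].
  by exists s, t.
by exists s; apply/existsP; exists t; rewrite fr eqxx.
Qed.

Lemma collapse_step_sub (T : finType) (K K' : {set {set T}}) :
  collapse_step K K' -> K' \subset K.
Proof. by case/collapse_stepP=> s [t [_ ->]]; apply: subsetDl. Qed.

Lemma inj_imset_sub (aT rT : finType) (f : aT -> rT) (A B : {set aT}) :
  injective f -> (f @: A \subset f @: B) = (A \subset B).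
Proof.
move=> injf; apply/idP/idP=> [/subsetP sub|]; last exact: imsetS.
by apply/subsetP=> x xA; rewrite -(mem_imset _ _ injf) sub ?imset_f.
Qed.

(** * Transport of collapses along an order embedding *)

Section Lift.
Variables (T T' : finType) (phi : {set T} -> {set T'}) (K : {set {set T'}}).
Hypothesis phi_sub : forall a b, (phi a \subset phi b) = (a \subset b).

(** Since no face of [K] contains a lifted face, [K] neither obstructs the freeness of the lifted
    pair nor loses a face in the collapse. *)
Lemma collapse_step_lift (L L' : {set {set T}}) :
  (forall k s, k \in K -> s \in L -> ~~ (phi s \subset k)) ->
  collapse_step L L' -> collapse_step (K :|: phi @: L) (K :|: phi @: L').
Proof.
move=> nsub /collapse_stepP[s [t [/free_pairP[sL st tL sub] ->]]].
apply/collapse_stepP; exists (phi s), (phi t); split.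
  apply/free_pairP; split.
  - by rewrite inE imset_f ?orbT.
  - by rewrite properE !phi_sub -properE.
  - by rewrite inE imset_f ?orbT.
  - move=> u; rewrite inE => /orP[uK|/imsetP[g gL ->]].
      by move=> su; have := nsub _ _ uK sL; rewrite su.
    by rewrite !phi_sub; apply: sub.
apply/setP=> h; rewrite !inE.
have [hK|hK] /= := boolP (h \in K); first by rewrite (negbTE (nsub _ _ hK sL)).
apply/imsetP/andP=> [[g]|[hN /imsetP[g gL def_h]]].
  by rewrite !inE => /andP[gN gL] ->; rewrite !phi_sub gN imset_f.
by exists g => //; move: hN; rewrite !inE def_h !phi_sub gL => ->.
Qed.

Lemma collapse_lift (L L' : {set {set T}}) :
  (forall k s, k \in K -> s \in L -> ~~ (phi s \subset k)) ->
  connect (@collapse_step _) L L' ->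
  connect (@collapse_step _) (K :|: phi @: L) (K :|: phi @: L').
Proof.
move=> nsub /connectP[p]; elim: p L nsub => [|M p IH] L nsub /=.
  by move=> _ ->.
case/andP=> LM pathp lastp; apply: connect_trans (connect1 _) (IH M _ _ _) => //.
  exact: collapse_step_lift LM.
(* Collapses only remove faces, so the condition on [L] passes to [M]. *)
move=> k s kK sM; apply: nsub => //.
exact: (subsetP (collapse_step_sub LM)).
Qed.

End Lift.

Lemma collapsible_imset (T T' : finType) (f : T -> T') (K : {set {set T}}) :
  injective f -> collapsible K ->
  collapsible [set f @: s | s : {set T} in K].
Proof.
move=> injf [v cK]; exists (f v).
have := @collapse_lift _ _ (fun s : {set T} => f @: s) set0
  (fun a b => inj_imset_sub a b injf) _ _ _ cK.
by rewrite !set0U !imset_set1; apply=> k s; rewrite inE.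
Qed.

(** * Gluing a new face along its link *)

Section Glue.
Variables (T T' : finType) (f : T -> T') (a : {set T'}).
Variables (K : {set {set T'}}) (L : {set {set T}}).
Hypotheses (f_inj : injective f) (f_notin : forall x, f x \notin a).

(** The link is collapsed with [a |: K] as the fixed part. Because [set0 \notin L], every lifted
    face properly contains [a], which is therefore not removed before the last step. *)
Lemma collapsible_glue :
  (forall k, k \in K -> ~~ (a \subset k)) -> set0 \notin L ->
  collapsible L -> collapsible K ->
  collapsible ((a |: K) :|: [set a :|: f @: s | s : {set T} in L]).
Proof.
move=> aK L0 [w cL] [v cK]; exists v; apply: connect_trans cK.
(* Disjointness from [a] lets [s] be recovered from [a :|: f @: s]. *)
have fa0 (s : {set T}) : f @: s :&: a = set0.
  apply/setP=> y; rewrite !inE; apply/andP=> -[/imsetP[x _ ->]].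
  exact/negP.
have phi_sub (s t : {set T}) : (a :|: f @: s \subset a :|: f @: t) = (s \subset t).
  rewrite -(inj_imset_sub s t f_inj) subUset subsetUl /= -subDset.
  suff -> : f @: s :\: a = f @: s by [].
  by apply/setDidPl; rewrite -setI_eq0 fa0.
apply: connect_trans (collapse_lift phi_sub _ cL) (connect1 _).
  move=> k s; rewrite !inE => /orP[/eqP ->|/aK akN] sL; last first.
    by apply: contra akN; rewrite subUset => /andP[].
  (* [a] is the lift of [set0], so the order embedding turns the claim into one about [set0]. *)
  have: ~~ (s \subset set0) by rewrite subset0; apply: contraNneq L0 => <-.
  by rewrite -phi_sub imset0 setU0.
have fwa : a \proper a :|: [set f w].
  by rewrite properE subsetUl subUset subxx sub1set f_notin.
rewrite imset_set1 imset_set1; apply/collapse_stepP.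
exists a, (a :|: [set f w]); split.
  apply/free_pairP; split=> //; rewrite ?inE ?eqxx ?orbT // => u.
  rewrite !inE => /orP[/orP[/eqP ->|/aK /negbTE ->]|/eqP ->] //.
  by rewrite (proper_sub fwa).
apply/setP=> h; rewrite !inE.
have [hK|hK] := boolP (h \in K); first by rewrite (negbTE (aK _ hK)) orbT.
rewrite orbF; case: eqP => [->|_]; first by rewrite subxx proper_sub.
by case: eqP => [->|_]; rewrite ?subxx ?(proper_sub fwa) ?andbF.
Qed.

End Glue.

(** * Cliques and clique complexes *)

Lemma is_cliqueP (G : sgraph) (A : {set G}) :
  reflect {in A &, forall x y, x != y -> edge x y} (is_clique A).
Proof.
apply: (iffP forall_inP) => [cA x y xA yA|cA x xA].
  by apply/implyP; apply: (forall_inP (cA x xA)).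
by apply/forall_inP=> y yA; apply/implyP; apply: cA.
Qed.

Lemma clique_imset (G H : sgraph) (f : G -> H) (A : {set G}) :
  injective f -> {mono f : x y / edge x y} ->
  is_clique (f @: A) = is_clique A.
Proof.
move=> injf monof; apply/is_cliqueP/is_cliqueP=> cA.
  move=> x y xA yA; rewrite -(inj_eq injf) -monof.
  by apply: cA; apply: imset_f.
move=> _ _ /imsetP[x xA ->] /imsetP[y yA ->].
by rewrite (inj_eq injf) monof; apply: cA.
Qed.

Lemma cliqueU (G : sgraph) (A B : {set G}) :
  is_clique A -> is_clique B ->
  {in A & B, forall x y, edge x y} -> is_clique (A :|: B).
Proof.
move=> /is_cliqueP cA /is_cliqueP cB AB; apply/is_cliqueP=> x y.
rewrite !inE => /orP[xA|xB] /orP[yA|yB]; [exact: cA| | |exact: cB] => _.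
  exact: AB.
by rewrite edge_sym AB.
Qed.

Lemma clique_sub (G : sgraph) (A B : {set G}) :
  A \subset B -> is_clique B -> is_clique A.
Proof.
move=> /subsetP AB /is_cliqueP cB; apply/is_cliqueP=> x y xA yA.
by apply: cB; apply: AB.
Qed.

Lemma clique_complex_set0 (G : sgraph) : set0 \notin clique_complex G.
Proof. by rewrite inE eqxx. Qed.

Lemma collapsible_graph_iso (G H : sgraph) :
  graph_iso G H -> collapsible_graph G -> collapsible_graph H.
Proof.
move=> [f [bijf monof]] /(collapsible_imset (bij_inj bijf)).
congr collapsible; apply/setP=> h; case: bijf (bij_inj bijf) => f' fK f'K injf.
apply/imsetP/idP=> [[s + ->]|].
  by rewrite !inE imset_eq0 clique_imset.
(* The inverse map shows that every clique of [H] is the image of a clique of [G]. *)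
have def_h : h = f @: (f' @: h).
  by rewrite -imset_comp (eq_imset _ f'K) imset_id.
by rewrite {1}def_h => hK; exists (f' @: h) => //; move: hK;
  rewrite !inE imset_eq0 clique_imset.
Qed.

(* [a] is the glued vertex or edge, [f] embeds its link [N] and [K] is the
   clique complex before gluing. *)
Lemma collapsible_graph_glue (H N : sgraph) (f : N -> H) (a : {set H})
    (K : {set {set H}}) :
  injective f -> {mono f : x y / edge x y} -> a != set0 -> is_clique a ->
  (forall y, reflect (exists x, y = f x) [forall z in a, edge z y]) ->
  (forall h, h \in K = (h \in clique_complex H) && ~~ (a \subset h)) ->
  collapsible_graph N -> collapsible K -> collapsible_graph H.
Proof.
move=> injf monof a0 ca link defK cN cK.
have f_edge x z : z \in a -> edge z (f x).
  by move=> za; have /link/forall_inP := ex_intro (fun x0 => f x = f x0) x erefl;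
    apply.
have f_notin x : f x \notin a.
  by apply/negP=> /(f_edge x); rewrite edge_irrefl.
have := collapsible_glue injf f_notin _ (clique_complex_set0 N) cN cK.
have aK k : k \in K -> ~~ (a \subset k) by rewrite defK => /andP[].
move=> /(_ aK); congr collapsible; apply/setP=> h; rewrite 2!inE in_set1 defK.
apply/idP/idP => [/orP[/orP[/eqP ->|/andP[]]|/imsetP[s + ->]] //|hC].
- by rewrite inE a0.
- rewrite !inE => /andP[s0 cs]; rewrite setU_eq0 negb_and a0 cliqueU //.
    by rewrite clique_imset.
  by move=> z _ za /imsetP[x _ ->]; apply: f_edge.
have [ah|] := boolP (a \subset h); last by rewrite hC orbT.
have [//|hNa] /= := eqVneq h a; rewrite andbF /=.
move: hC; rewrite inE => /andP[h0 ch].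
(* A vertex of the clique [h] outside [a] is adjacent to all of [a], hence by [link] a value of
   [f]. *)
have def_h : h = a :|: f @: (f @^-1: h).
  apply/eqP; rewrite eqEsubset subUset ah /=; apply/andP; split; last first.
    by apply/subsetP=> _ /imsetP[x + ->]; rewrite inE.
  apply/subsetP=> y yh; rewrite inE; have [//|yNa] /= := boolP (y \in a).
  have /link[x def_y] : [forall z in a, edge z y].
    apply/forall_inP=> z za; apply: (elimT (is_cliqueP h) ch) => //.
      exact: (subsetP ah).
    by apply: contraNneq yNa => <-.
  by rewrite def_y imset_f // inE -def_y.
apply/imsetP; exists (f @^-1: h) => //; rewrite inE; apply/andP; split.
  by apply: contra_neq hNa => e; rewrite def_h e imset0 setU0.
rewrite -(clique_imset _ injf monof); apply: clique_sub ch.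
by rewrite {2}def_h subsetUr.
Qed.

(** * The two gluing operations and the induction *)

Lemma collapsible_graph_add_vertex (G : sgraph) (A : {set G}) :
  collapsible_graph G -> collapsible_graph (induced A) ->
  collapsible_graph (add_vertex A).
Proof.
move=> cG cA.
have SomeI : injective (Some : G -> add_vertex A) by move=> x y [].
apply: (@collapsible_graph_glue (add_vertex A) (induced A)
          (fun x => Some (val x)) [set None]
          [set Some @: s | s : {set G} in clique_complex G]) => //.
- by move=> x y [] /val_inj.
- by apply/set0Pn; exists None; rewrite inE.
- by apply/is_cliqueP=> x y; rewrite !inE => /eqP -> /eqP ->; rewrite eqxx.
- move=> y; apply: (iffP forall_inP) => [/(_ None)|[x ->] z].
    rewrite inE eqxx => /(_ isT); case: y => //= y yA.
    by exists (exist _ y yA : induced A).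
  by rewrite inE => /eqP -> /=; apply: (valP x).
- move=> h; rewrite sub1set; apply/imsetP/andP=> [[s sK ->]|[hC hN]].
    split; last by apply/imsetP=> -[].
    by move: sK; rewrite !inE imset_eq0 (@clique_imset G (add_vertex A)).
  (* A clique avoiding [None] comes entirely from [G]. *)
  have def_h : h = Some @: (Some @^-1: h).
    apply/setP=> -[x|]; first by rewrite (mem_imset _ _ SomeI) inE.
    by rewrite (negbTE hN); apply/esym/imsetP=> -[].
  exists (Some @^-1: h) => //; move: hC; rewrite {1}def_h !inE imset_eq0.
  by rewrite (@clique_imset G (add_vertex A)).
- exact: collapsible_imset.
Qed.

Lemma collapsible_graph_add_edge (G : sgraph) (v1 v2 : G) :
  v1 != v2 -> ~~ edge v1 v2 ->
  collapsible_graph G -> collapsible_graph (induced (common_nbrs v1 v2)) ->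
  collapsible_graph (add_edge v1 v2).
Proof.
move=> v12 nv12 cG cN.
(* The unordered pair in [add_edge_edge] is split into its two orientations. *)
have edgeE (x y : G) : edge (x : add_edge v1 v2) y =
    edge x y || (x == v1) && (y == v2) || (x == v2) && (y == v1).
  rewrite {1}/edge /= /add_edge_edge -orbA; congr orb.
  apply/andP/orP=> [[xy /eqP/setP e]|[] /andP[/eqP -> /eqP ->]]; last first.
  - by rewrite eq_sym v12 setUC eqxx.
  - by rewrite v12 eqxx.
  move: (e x) (e y); rewrite !inE !eqxx orbT /=.
  move=> /esym/orP[]/eqP ex /esym/orP[]/eqP ey.
  - by move: xy; rewrite ex ey eqxx.
  - by left; rewrite ex ey !eqxx.
  - by right; rewrite ex ey !eqxx.
  - by move: xy; rewrite ex ey eqxx.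
have v21 : v2 != v1 by rewrite eq_sym.
apply: (@collapsible_graph_glue (add_edge v1 v2) (induced (common_nbrs v1 v2))
          val [set v1; v2] (clique_complex G)) => //.
- exact: val_inj.
- move=> x y; rewrite edgeE.
  (* By irreflexivity the endpoints are not common neighbours, so the new edge leaves adjacency
     within the link unchanged. *)
  have nbr (z : induced (common_nbrs v1 v2)) : (val z != v1) && (val z != v2).
    have:= valP z; rewrite inE => /andP[z1 z2].
    by apply/andP; split; [apply: contraTneq z1 | apply: contraTneq z2];
      move=> ->; rewrite edge_irrefl.
  by have /andP[/negbTE -> /negbTE ->] := nbr x; rewrite !orbF.
- by apply/set0Pn; exists v1; rewrite !inE eqxx.
- apply/is_cliqueP=> x y; rewrite !inE.
  by move=> /orP[]/eqP -> /orP[]/eqP ->; rewrite ?eqxx // edgeE !eqxx ?orbT.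
- move=> y; apply: (iffP forall_inP) => [cy|[x ->] z].
    (* Neither endpoint is adjacent to itself, so [y] differs from both and its two adjacencies are
       old edges. *)
    have yN : y \in common_nbrs v1 v2.
      move: (cy v1) (cy v2); rewrite !inE !eqxx orbT !edgeE !eqxx.
      rewrite (negbTE v12) (negbTE v21) /= !orbF => /(_ isT) e1 /(_ isT) e2.
      have [ey|yv1] := eqVneq y v1.
        by move: e1; rewrite ey edge_irrefl (negbTE v12).
      have [ey|yv2] := eqVneq y v2.
        by move: e2; rewrite ey edge_irrefl (negbTE v21).
      by move: e1 e2; rewrite (negbTE yv1) (negbTE yv2) !orbF => -> ->.
    by exists (exist _ y yN : induced (common_nbrs v1 v2)).
  have:= valP x; rewrite !inE => /andP[x1 x2] /orP[]/eqP ->; rewrite edgeE.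
    by rewrite x1.
  by rewrite x2.
(* An old clique cannot contain both nonadjacent endpoints; conversely, a clique missing one of them
   uses only old edges. *)
move=> h; rewrite !inE -andbA; congr (_ && _).
apply/idP/andP=> [/is_cliqueP ch|[/is_cliqueP ch ah]].
  split; first by apply/is_cliqueP=> x y xh yh xy; rewrite edgeE ch.
  rewrite subUset !sub1set; apply: contra nv12 => /andP[v1h v2h].
  exact: ch.
apply/is_cliqueP=> x y xh yh xy; have:= ch x y xh yh xy.
rewrite edgeE -orbA => /or3P[//||] /andP[/eqP ex /eqP ey]; case/negP: ah;
  by rewrite subUset !sub1set -ex -ey xh yh.
Qed.

Lemma collapsible_K1 : collapsible_graph K1.
Proof.
exists tt; suff -> : clique_complex K1 = [set [set tt]] by apply: connect0.
apply/setP=> h; rewrite !inE; apply/andP/eqP=> [[/set0Pn[[] th] _]|->].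
  by apply/setP=> -[]; rewrite th inE.
split; first by apply/set0Pn; exists tt; rewrite inE.
by apply/is_cliqueP=> -[] [].
Qed.

Theorem theorem3 (G : sgraph) (hG : strong_contractible G) :
  collapsible_graph G.
Proof.
(* The neighbourhoods are strong contractible by derivation too, so the induction also yields their
   collapsibility. *)
elim: hG => {G} [|G A _ cG _ cA|G v1 v2 _ cG v12 nv12 _ cN|G H iGH _ cG].
- exact: collapsible_K1.
- exact: collapsible_graph_add_vertex.
- exact: collapsible_graph_add_edge.
- exact: collapsible_graph_iso iGH cG.
Qed.
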